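(* Let $\nu=(\nu_1,\dots,\nu_\ell)$ be an integer partition. Then there exist rational numbers $\xi_\delta$, indexed by integer partitions $\delta$ with $|\delta|\le|\nu|-1$, such that for every strict partition $\lambda$, $$D\Bigl(\frac{q_\nu(\lambda)}{H_\lambda}\Bigr)=\sum_{|\delta|\le|\nu|-1}\xi_\delta\,\frac{q_\delta(\lambda)}{H_\lambda}.$$
   Context: A strict partition is a finite strictly decreasing sequence of positive integers $\lambda=(\lambda_1>\cdots>\lambda_\ell)$ (the empty sequence is allowed); $\ell(\lambda)=\ell$, and $\lambda_i=0$ for $i>\ell(\lambda)$. The (shifted Young) diagram of $\lambda$ is the set of boxes $(i,j)$ with $1\le i\le\ell(\lambda)$, $i+1\le j\le i+\lambda_i$ (row $i$, column $j$); $\lambda$ is identified with its diagram. The hook length $h_\square$ of $\square=(i,j)\in\lambda$ is the number of boxes of $\lambda$ in row $i$ strictly to the right of $\square$, plus the number of boxes $(i',j)\in\lambda$ with $i'>i$, plus $1$, plus $\lambda_j$; $H_\lambda=\prod_{\square\in\lambda}h_\square$ ($H_\emptyset=1$). An outer corner of $\lambda$ is a box of $\lambda$ whose removal leaves the diagram of a strict partition. Let $(\alpha_1,\beta_1),\dots,(\alpha_m,\beta_m)$ be the outer corners with $\alpha_1>\cdots>\alpha_m$, and $y_j=\beta_j-\alpha_j$. Set $\alpha_{m+1}=0$, $\beta_0=\ell(\lambda)+1$, and $x_i=\beta_i-\alpha_{i+1}$ for $0\le i\le m$. For $k\ge0$, $q_k(\lambda)=\sum_{i=0}^m\binom{x_i}{2}^k-\sum_{i=1}^m\binom{y_i}{2}^k$,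 and for an integer partition $\nu=(\nu_1,\dots,\nu_\ell)$, $q_\nu(\lambda)=\prod_{j=1}^\ell q_{\nu_j}(\lambda)$ ($q_\emptyset=1$). $\lambda^+$ ranges over strict partitions obtained from $\lambda$ by adding one box; the difference operator is $DG(\lambda)=\sum_{\lambda^+:\ell(\lambda^+)>\ell(\lambda)}G(\lambda^+)+2\sum_{\lambda^+:\ell(\lambda^+)=\ell(\lambda)}G(\lambda^+)-G(\lambda)$. *)

(* Defs.v *)
(* Strict partitions are sequences of nat; rows are 1-indexed. *)
From mathcomp Require Import all_boot all_order all_algebra.
Set Implicit Arguments. Unset Strict Implicit. Unset Printing Implicit Defensive.
Import Order.TTheory GRing.Theory Num.Theory.

(* lambda_i, 1-indexed, = 0 for i > l(lambda) (and for i = 0) *)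
Definition part (la : seq nat) (i : nat) : nat := if i is 0 then 0 else nth 0 la i.-1.

Definition is_strict (la : seq nat) : bool := sorted gtn la && all (fun x => 0 < x) la.

Definition is_partition (nu : seq nat) : bool := sorted geq nu && all (fun x => 0 < x) nu.

Definition in_diagram (la : seq nat) (i j : nat) : bool :=
  [&& 1 <= i, i <= size la, i.+1 <= j & j <= i + part la i].

Definition hook (la : seq nat) (i j : nat) : nat :=
  (i + part la i - j)
  + count (fun i' => (i < i') && in_diagram la i' j) (iota 1 (size la))
  + 1 + part la j.

Definition Hprod (la : seq nat) : nat :=
  \prod_(i <- iota 1 (size la)) \prod_(j <- iota i.+1 (part la i)) hook la i j.

(* the sequence obtained by removing the last box of row i (1 <= i <= l):
   if that row becomes empty (necessarily only meaningful for the last row)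
   the row is dropped. *)
Definition rem_box (la : seq nat) (i : nat) : seq nat :=
  if (i == size la) && (part la i == 1) then take i.-1 la
  else set_nth 0 la i.-1 (part la i).-1.

(* rows alpha of the outer corners (alpha, alpha + lambda_alpha), listed with
   alpha_1 > ... > alpha_m : the last box of row alpha is an outer corner iff
   removing it leaves a strict partition. *)
Definition corner_rows (la : seq nat) : seq nat :=
  [seq i <- rev (iota 1 (size la)) | is_strict (rem_box la i)].

Definition xs (la : seq nat) : seq nat :=
  let a := corner_rows la in
  let betas := (size la).+1 :: [seq i + part la i | i <- a] in
  let alphas := a ++ [:: 0] in
  [seq (p.1 - p.2)%N | p <- zip betas alphas].

Definition ys (la : seq nat) : seq nat :=
  [seq ((i + part la i) - i)%N | i <- corner_rows la].

Local Open Scope ring_scope.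

Definition qk (k : nat) (la : seq nat) : rat :=
  \sum_(x <- xs la) ('C(x, 2))%:R ^+ k - \sum_(y <- ys la) ('C(y, 2))%:R ^+ k.

Definition qnu (nu : seq nat) (la : seq nat) : rat := \prod_(k <- nu) qk k la.

(* adding a box to row i (1 <= i <= l+1); row l+1 means a new row of length 1 *)
Definition add_box (la : seq nat) (i : nat) : seq nat := incr_nth la i.-1.

Definition Dop (G : seq nat -> rat) (la : seq nat) : rat :=
  \sum_(i <- iota 1 (size la).+1 | is_strict (add_box la i) &&
           (size la < size (add_box la i))%N) G (add_box la i)
  + 2%:R * \sum_(i <- iota 1 (size la).+1 | is_strict (add_box la i) &&
           (size (add_box la i) == size la)) G (add_box la i)
  - G la.

(* Main.v *)
(** Write u_t = C(t+1, 2) and v_t = C(t, 2) for a part t of la.  Telescoping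
    over maximal runs of consecutive parts turns q_k (k > 0) into the difference
    of power sums [\sum_(t <- la) (u_t ^ k - v_t ^ k)].  By the shifted hook
    formula, the weighted ratio H_la / H_la+ for the part s growing to s + 1
    (s = 0 for a new row) is the residue at z = u_s of
    [(1 / z) \prod_(t <- la) (z - v_t) / (z - u_t)]; it vanishes when the box
    cannot be added.  Hence the sums of residue * u_s ^ k are the coefficients
    of [\prod_t (1 - v_t x) / (1 - u_t x)], which by Newton's identities are
    polynomials in the q_j of weight k.  Finally q_k(la+) - q_k(la) is a
    polynomial in u_s of degree at most k - 1, so expanding q_nu(la+) loses at
    least one unit of weight. *)
Require Import Defs.
From mathcomp Require Import all_boot all_order all_algebra ring lra zify.
Import GRing.Theory Num.Theory.
Local Open Scope ring_scope.

(** * Residues at triangular numbers and their moments *)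

Definition tri (s : nat) : rat := ('C(s, 2))%:R.

Lemma triS s : tri s.+1 = tri s + s%:R.
Proof. by rewrite /tri binS bin1 natrD. Qed.

Lemma triE s : tri s = s%:R * (s%:R - 1) / 2%:R.
Proof.
elim: s => [|s IH]; first by rewrite /tri bin0n !mul0r.
by rewrite triS IH -natr1; field.
Qed.

Lemma triB_pred s t :
  tri s.+1 - tri t = (s.+1%:R - t%:R) * (s%:R + t%:R) / 2%:R.
Proof. by rewrite !triE -natr1; field. Qed.

Lemma triB_succ s t :
  tri s.+1 - tri t.+1 = (s%:R - t%:R) * (s + t).+1%:R / 2%:R.
Proof. by rewrite !triE -!natr1 natrD; field. Qed.

Lemma triB_neq0 (s t : nat) : s != t -> tri s.+1 - tri t.+1 != 0.
Proof.
move=> st; rewrite triB_succ !mulf_neq0 ?invr_eq0 ?pnatr_eq0 //.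
by rewrite subr_eq0 eqr_nat.
Qed.

(* Weights in the difference operator, where s = 0 stands for a new row. *)
Definition wt (s : nat) : rat := if s == 0 then 1 else 2%:R.

(** The quotient [wt s / s.+1%:R] collects [1 / z] and the numerator of the factor at the pole: it
    is [s / tri s.+1] for [s > 0], and 1 for [s = 0], where the pole is that of [1 / z] itself
    because [tri 1 = 0]. Keeping the factor 2 of the difference operator in [wt] makes both cases
    uniform. *)
Definition res (la : seq nat) (s : nat) : rat :=
  wt s / s.+1%:R *
  \prod_(t <- la | t != s) ((tri s.+1 - tri t) / (tri s.+1 - tri t.+1)).

Lemma res_cons (a : nat) la (s : nat) : s != a ->
  res (a :: la) s = res la s * ((tri s.+1 - tri a) / (tri s.+1 - tri a.+1)).
Proof.
by move=> sa; rewrite /res big_cons eq_sym sa -[RHS]mulrA; congr (_ * _); rewrite mulrC.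
Qed.

Lemma res_head (a : nat) (la : seq nat) : a != 0%N -> a \notin la ->
  res (a :: la) a = a%:R / tri a.+1 *
    \prod_(t <- la) ((tri a.+1 - tri t) / (tri a.+1 - tri t.+1)).
Proof.
move=> a0 aN; rewrite /res big_cons eqxx /= /wt (negPf a0); congr (_ * _); last first.
  rewrite big_seq_cond [RHS]big_seq; apply: eq_bigl => t.
  by case: (boolP (t \in la)) => //= tla; apply: contraNneq aN => <-.
by rewrite triE -natr1; field; rewrite [1 + _]addrC addrK natr1 !pnatr_eq0 a0.
Qed.

Lemma big_cons2 (F : nat -> rat) a b la :
  \sum_(s <- a :: b :: la) F s = F b + \sum_(s <- a :: la) F s.
Proof. by rewrite !big_cons addrCA. Qed.

Lemma res_partial_fraction la z : uniq la -> 0%N \notin la ->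
  (forall s, s \in 0%N :: la -> z != tri s.+1) ->
  \sum_(s <- 0%N :: la) res la s / (z - tri s.+1) =
  z^-1 * \prod_(t <- la) ((z - tri t) / (z - tri t.+1)).
Proof.
elim: la z => [|a la IH] z /=.
  by move=> _ _ zP; rewrite big_seq1 /res !big_nil /wt /= divr1 mulr1 mul1r /tri subr0 mulr1.
move=> /andP[aN ula]; rewrite inE negb_or eq_sym => /andP[a0 laN] zP.
have zS s : s \in 0%N :: la -> z != tri s.+1.
  by move=> sP; apply: zP; move: sP; rewrite !inE => /orP[] ->; rewrite ?orbT.
have za : z - tri a.+1 != 0 by rewrite subr_eq0 zP // !inE eqxx orbT.
have a0la : a \notin 0%N :: la by rewrite inE negb_or a0.
(* The constant [a%:R] is [tri a.+1 - tri a]. *)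
have E : \sum_(s <- 0%N :: la) res (a :: la) s / (z - tri s.+1) =
   (z - tri a) / (z - tri a.+1) * (\sum_(s <- 0%N :: la) res la s / (z - tri s.+1))
   - a%:R / (z - tri a.+1) *
     (\sum_(s <- 0%N :: la) res la s / (tri a.+1 - tri s.+1)).
  rewrite !mulr_sumr -sumrB; apply: eq_big_seq => s sP.
  have sa : s != a by apply: contraNneq a0la => <-.
  rewrite res_cons // triS in za *.
  have zs := zS _ sP; rewrite -subr_eq0 in zs.
  have := triB_neq0 _ _ sa; have := triB_neq0 a s; rewrite eq_sym sa => /(_ isT).
  rewrite triS in za * => h1 h2.
  by field; rewrite za zs h1 h2.
rewrite big_cons2 [in RHS]big_cons E (IH z) // (IH (tri a.+1)) //; last first.
  move=> s sP; rewrite -subr_eq0 triB_neq0 //; apply: contraNneq a0la => ->.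
  by [].
rewrite res_head //.
set A := \prod_(t <- la) _; set B := \prod_(t <- la) _.
have ta : tri a.+1 != 0.
  by have := triB_neq0 a 0%N a0; rewrite /(tri 1) subr0.
have z0 : z != 0 by apply: (zS 0%N); rewrite inE.
by field; rewrite za ta z0.
Qed.

Definition moment (la : seq nat) (k : nat) : rat :=
  \sum_(s <- 0%N :: la) res la s * tri s.+1 ^+ k.

Definition qsum (k : nat) (la : seq nat) : rat :=
  \sum_(t <- la) (tri t.+1 ^+ k - tri t ^+ k).

(** The underlying rational function behaves like [1 / z] at infinity. The induction avoids limits:
    the total change of the old residues, evaluated by partial fractions at [tri a.+1], cancels the
    new residue. *)
Lemma moment0 la : uniq la -> 0%N \notin la -> moment la 0 = 1.
Proof.
elim: la => [|a la IH] /=.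
  by move=> _ _; rewrite /moment big_seq1 /res big_nil /wt /= divr1 !mulr1.
move=> /andP[aN ula]; rewrite inE negb_or eq_sym => /andP[a0 laN].
have a0la : a \notin 0%N :: la by rewrite inE negb_or a0.
have ta : tri a.+1 != 0.
  by have := triB_neq0 a 0%N a0; rewrite /(tri 1) subr0.
rewrite -[RHS](IH ula laN) /moment big_cons2.
have -> : \sum_(s <- 0%N :: la) res (a :: la) s * tri s.+1 ^+ 0 =
   \sum_(s <- 0%N :: la) res la s * tri s.+1 ^+ 0
   - a%:R * \sum_(s <- 0%N :: la) res la s / (tri a.+1 - tri s.+1).
  rewrite mulr_sumr -sumrB; apply: eq_big_seq => s sP.
  have sa : s != a by apply: contraNneq a0la => <-.
  rewrite res_cons // !expr0 !mulr1.
  have := triB_neq0 _ _ sa; have := triB_neq0 a s; rewrite eq_sym sa => /(_ isT).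
  rewrite [tri a.+1]triS => h1 h2.
  by field; rewrite h1 h2.
rewrite res_partial_fraction //; last first.
  by move=> s sP; rewrite -subr_eq0 triB_neq0 //; apply: contraNneq a0la => ->.
rewrite res_head // expr0.
by field.
Qed.

(** The weight [tri s.+1 - tri a.+1] kills the term of the new pole and clears the denominator in
    every other residue. In generating series this is multiplication by [(1 - v x) / (1 - u x)],
    with [u = tri a.+1] and [v = tri a]. *)
Lemma moment_cons (a : nat) la k : a != 0%N -> a \notin la ->
  moment (a :: la) k.+1 - tri a.+1 * moment (a :: la) k =
  moment la k.+1 - tri a * moment la k.
Proof.
move=> a0 aN; have a0la : a \notin 0%N :: la by rewrite inE negb_or a0.
rewrite /moment !mulr_sumr -!sumrB big_cons2.
rewrite [X in X + _](_ : _ = 0) ?add0r; last by rewrite exprS; ring.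
apply: eq_big_seq => s sP.
have sa : s != a by apply: contraNneq a0la => <-.
by rewrite res_cons // exprS; field; apply: triB_neq0.
Qed.

(* Newton's identity for the coefficients g of a power series, under
   multiplication of the series by (1 - v x) / (1 - u x). *)
Lemma newton_step (u v : rat) (q g g' : nat -> rat) :
  g' 0%N = g 0%N ->
  (forall k, g' k.+1 - u * g' k = g k.+1 - v * g k) ->
  g 0%N = 1 ->
  (forall k, k.+1%:R * g k.+1 = \sum_(i < k.+1) q i.+1 * g (k - i)%N) ->
  forall k, k.+1%:R * g' k.+1 =
    \sum_(i < k.+1) (q i.+1 + u ^+ i.+1 - v ^+ i.+1) * g' (k - i)%N.
Proof.
move=> g0 gS g1 qg.
pose conv (a h : nat -> rat) k : rat := \sum_(i < k.+1) a i.+1 * h (k - i)%N.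
have convS a k : conv a g' k.+1 - u * conv a g' k = conv a g k.+1 - v * conv a g k.
  rewrite /conv !mulr_sumr big_ord_recr [in RHS]big_ord_recr /= subnn g0.
  rewrite addrAC [RHS]addrAC; congr (_ + _); rewrite -!sumrB.
  apply: eq_bigr => i _; rewrite subSn ?leq_ord //.
  by rewrite !(mulrCA _ (a _)) -!mulrBr gS.
(* The logarithmic derivative of the new factor contributes the geometric sequences of [u] and [v];
   multiplying such a convolution by [1 - x t], in the series variable [t], leaves a single term. *)
have convX (x : rat) h k : conv (GRing.exp x) h k.+1 - x * conv (GRing.exp x) h k = x * h k.+1.
  rewrite /conv big_ord_recl subn0 expr1 mulr_sumr /= -addrA -sumrB big1 ?addr0 //.
  by move=> i _; rewrite /bump /= add1n subSS exprS mulrA subrr.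
have convE k : \sum_(i < k.+1) (q i.+1 + u ^+ i.+1 - v ^+ i.+1) * g' (k - i)%N =
   conv q g' k + conv (GRing.exp u) g' k - conv (GRing.exp v) g' k.
  rewrite /conv -big_split /= -sumrB; apply: eq_bigr => i _.
  by rewrite mulrBl mulrDl.
elim=> [|k IH]; rewrite convE.
  have := qg 0%N; rewrite /conv !big_ord1 !subnn g0 g1 !expr1 => e.
  have := gS 0%N; rewrite g0 g1 => e'. lra.
rewrite convE in IH.
have := qg k.+1; rewrite -/(conv q g k.+1).
have := qg k; rewrite -/(conv q g k).
have := convS q k; have := convX u g' k; have := convS (GRing.exp v) k.
have := convX v g k; have := gS k.+1.
rewrite -(natr1 k.+1) => e1 e2 e3 e4 e5 e6 e7.
(* The recurrence for [g'] isolates [k.+1%:R * g' k.+1], to which the induction hypothesis applies;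
   what is left is linear in the convolutions. *)
have -> : (k.+1%:R + 1) * g' k.+2 = (k.+1%:R + 1) * (g k.+2 - v * g k.+1) + u * g' k.+1
      + u * (k.+1%:R * g' k.+1).
  rewrite -e1; ring.
rewrite IH mulrBr e7 [_ * (v * _)]mulrDl mul1r mulrCA e6.
lra.
Qed.

Lemma moment_newton la : uniq la -> 0%N \notin la -> forall k,
  k.+1%:R * moment la k.+1 = \sum_(i < k.+1) qsum i.+1 la * moment la (k - i)%N.
Proof.
elim: la => [|a la IH] /=.
  move=> _ _ k; rewrite /moment big_seq1 exprS [tri 1](_ : _ = 0) // mul0r !mulr0.
  by rewrite big1 // => i _; rewrite /qsum big_nil mul0r.
move=> /andP[aN ula]; rewrite inE negb_or eq_sym => /andP[a0 laN] k.
have N : 0%N \notin a :: la by rewrite inE negb_or eq_sym a0.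
rewrite (newton_step (tri a.+1) (tri a) (fun i => qsum i la) (moment la)) //.
- by apply: eq_bigr => i _; congr (_ * _); rewrite /qsum big_cons [RHS]addrC addrA.
- by rewrite !moment0 //= aN.
- by move=> j; rewrite moment_cons.
- by rewrite moment0.
- exact: IH.
Qed.

(** * The shifted hook length formula *)

Lemma big_iotaS (R : Type) (idx : R) (op : R -> R -> R) m n (F : nat -> R) :
  \big[op/idx]_(i <- iota m.+1 n) F i = \big[op/idx]_(i <- iota m n) F i.+1.
Proof. by rewrite -add1n iotaDl big_map. Qed.

Lemma count_iotaS (P : pred nat) m n :
  count P (iota m.+1 n) = count (fun i => P i.+1) (iota m n).
Proof. by rewrite -add1n iotaDl count_map. Qed.

Lemma path_gtn_size m la : path gtn m la -> (size la <= m)%N.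
Proof. by elim: la m => [|t la IH] m //= /andP[mt /IH]; lia. Qed.

Lemma path_gtn_part m la : path gtn m la ->
  forall i, (i.+1 + part la i.+1 <= m)%N \/ (size la <= i)%N.
Proof.
elim: la m => [|t la IH] m //= => [_ i|/andP[mt pt] [|i]] /=; first by right.
  by left; lia.
by case: (IH _ pt i) => /=; [left|right]; lia.
Qed.

Lemma path_gtn_part_ge m la : path gtn m la ->
  forall i, (i < size la)%N -> (size la <= i.+1 + part la i.+1)%N.
Proof.
elim: la m => [|t la IH] m //= /andP[_ pt] [|i] /= il.
  by have := path_gtn_size _ _ pt; lia.
by have := IH _ pt i; rewrite /=; lia.
Qed.

Lemma prod_iota_fact a c n : (c + n <= a)%N ->
  (\prod_(j <- iota c n) (a - j) * (a - c - n)`! = (a - c)`!)%N.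
Proof.
elim: n c => [|n IH] c cn; first by rewrite big_nil mul1n subn0.
rewrite big_cons -mulnA; have := IH c.+1.
rewrite (_ : (a - c.+1 - n)%N = (a - c - n.+1)%N); last by lia.
move=> -> ; last by lia.
by rewrite (_ : (a - c)%N = (a - c.+1).+1) ?factS //; lia.
Qed.

(* For b = a this says that the hooks of a new first row of length a lying right
   of column size la + 1, together with the differences a - t, are exactly 1, ..., a;
   the bound b makes the induction on la go through. *)
Lemma long_columns_prod la a b : path gtn b la -> (b <= a)%N ->
  (\prod_(j <- iota (size la).+1 (b - size la))
      (a.+1 - j + count (fun i => j <= i + part la i) (iota 1 (size la)))
    * \prod_(t <- la) (a - t) * (a - b)`! = a`!)%N.
Proof.
elim: la a b => [|m la IH] a b /=.
  move=> _ ba; rewrite big_nil muln1 subn0.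
  under eq_bigr do rewrite addn0.
  have := @prod_iota_fact a.+1 1 b; rewrite subSS subn0 => -> //; lia.
move=> /andP[/= mb pm] ba.
have sm := path_gtn_size _ _ pm.
(* Columns up to [m.+1] are met by the row of [m], whose unit in the count offsets the shift of the
   column index, so the induction hypothesis applies with bound [m]. Later columns are met by no row
   of the tail, and their factors form a quotient of factorials. *)
rewrite (_ : (b - (size la).+1 = (m - size la) + (b - m.+1))%N); last by lia.
rewrite iotaD big_cat /= big_cons.
rewrite (_ : ((size la).+2 + (m - size la))%N = m.+2); last by lia.
set A := (\prod_(j <- iota _ (m - _)) _)%N; set B := (\prod_(j <- iota _ (b - _)) _)%N.
have -> : A = (\prod_(j <- iota (size la).+1 (m - size la))
      (a.+1 - j + count (fun i => j <= i + part la i) (iota 1 (size la))))%N.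
  rewrite /A big_iotaS; apply: eq_big_seq => j; rewrite mem_iota => /andP[j1 j2].
  rewrite count_iotaS (_ : (j.+1 <= 1 + m)%N = true); last by lia.
  have -> : count (fun i => (j < i.+1 + nth 0 (m :: la) i)%N) (iota 1 (size la)) =
            count (fun i => (j <= i + part la i)%N) (iota 1 (size la)).
    by apply: eq_in_count => i; rewrite mem_iota; case: i.
  by rewrite /=; lia.
have Bf : (B * (a - b)`! = (a - m.+1)`!)%N.
  have := @prod_iota_fact a.+1 m.+2 (b - m.+1).
  rewrite (_ : (a.+1 - m.+2 - (b - m.+1) = a - b)%N); last by lia.
  rewrite subSS => <-; last by lia.
  congr (_ * _)%N; apply: eq_big_seq => j; rewrite mem_iota => /andP[j1 j2].
  rewrite (_ : (j <= 1 + m)%N = false); last by lia.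
  rewrite add0n count_iotaS (@eq_in_count _ _ pred0) ?count_pred0 ?addn0 //.
  move=> i; rewrite mem_iota /= => /andP[i1 i2].
  case: i i1 i2 => // i _ i2 /=; case: (path_gtn_part _ _ pm i) => /=; lia.
have := IH a m pm; rewrite (_ : (a - m = (a - m.+1).+1)%N); last by lia.
rewrite factS -Bf => <-; last by lia.
rewrite (_ : ((a - m.+1).+1 = a - m)%N); last by lia.
set X := (\prod_(j <- _) _)%N; set Y := (\prod_(j <- _) _)%N.
by ring.
Qed.

Lemma in_diagram_cons a la i j : (0 < i)%N ->
  in_diagram (a :: la) i.+1 j.+1 = in_diagram la i j.
Proof. by case: i => // i _; rewrite /in_diagram /= addSn !ltnS. Qed.

Lemma hook_cons a la i j : (0 < i)%N -> (0 < j)%N ->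
  hook (a :: la) i.+1 j.+1 = hook la i j.
Proof.
move=> i0 j0; rewrite /hook /= count_iotaS.
rewrite (@eq_in_count _ _ (fun i' => (i < i')%N && in_diagram la i' j)); last first.
  by move=> i'; rewrite mem_iota => /andP[i1 _]; rewrite in_diagram_cons.
by case: i i0 => // i _; case: j j0 => // j _; rewrite /= addSn subSS ltn0.
Qed.

Lemma hook_first_row a la j : (0 < j <= a)%N -> path gtn a la ->
  hook (a :: la) 1 j.+1 =
  (a.+1 - j + count (fun i => (i < j) && (j <= i + part la i)) (iota 1 (size la)) + part la j)%N.
Proof.
move=> /andP[j0 ja] pa; rewrite /hook /= count_iotaS.
rewrite (@eq_in_count _ _ (fun i => (i < j)%N && (j <= i + part la i)%N)); last first.
  move=> i; rewrite mem_iota add1n => /andP[i1 il].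
  by rewrite in_diagram_cons // /in_diagram; case: (i < j)%N; lia.
by case: j j0 ja => // j _ ja; rewrite /=; lia.
Qed.

(** In the first row, columns [2] to [(size la).+1] have hook lengths [a + t], one for each part [t]
    of [la]; the columns beyond them are the subject of [long_columns_prod]. *)
Lemma first_row_prod a la : path gtn a la ->
  (\prod_(j <- iota 2 a) hook (a :: la) 1 j * \prod_(t <- la) (a - t) =
   a`! * \prod_(t <- la) (a + t))%N.
Proof.
move=> pa; have sa := path_gtn_size _ _ pa.
have -> : iota 2 a = iota 2 (size la) ++ iota (size la).+2 (a - size la).
  by rewrite -{1}(subnKC sa) iotaD.
rewrite big_cat /= big_iotaS [X in (_ * X * _)%N]big_iotaS.
have -> : (\prod_(j <- iota 1 (size la)) hook (a :: la) 1 j.+1 = \prod_(t <- la) (a + t))%N.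
  rewrite [RHS](big_nth 0%N) big_iotaS /index_iota subn0.
  apply: eq_big_seq => j; rewrite mem_iota add0n => /andP[_ jl].
  rewrite hook_first_row //; last by lia.
  rewrite /= -[RHS]/(a + nth 0 la j)%N; congr (_ + _)%N.
  (* Every row of [la] reaches column [size la], so exactly the rows [1] to [j] are counted. *)
  rewrite (_ : count _ _ = j); first by lia.
  rewrite -(subnKC (ltnW jl)) iotaD count_cat [X in (_ + X)%N](@eq_in_count _ _ pred0); last first.
    by move=> i; rewrite mem_iota /=; lia.
  rewrite count_pred0 addn0 (@eq_in_count _ _ predT) ?count_predT ?size_iota //; last first.
  move=> i; rewrite mem_iota /= => /andP[i1 i2]; apply/andP; split; first by lia.
  case: i i1 i2 => // i _ i2; have := path_gtn_part_ge _ _ pa i; rewrite /=; lia.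
rewrite -(long_columns_prod la a a pa (leqnn a)) subnn fact0 muln1.
rewrite [RHS]mulnC -mulnA; congr (_ * (_ * _))%N.
apply: eq_big_seq => j; rewrite mem_iota => /andP[j1 j2].
rewrite hook_first_row //; last by lia.
rewrite (_ : part la j = 0%N) ?addn0; last first.
  by case: j j1 j2 => // j; rewrite /= => h _; rewrite nth_default //; lia.
congr (_ + _)%N; apply: eq_in_count => i; rewrite mem_iota => /andP[i1 i2].
by rewrite (_ : (i < j)%N) //; lia.
Qed.

Lemma Hprod_cons a la : Hprod (a :: la) =
  (\prod_(j <- iota 2 a) hook (a :: la) 1 j * Hprod la)%N.
Proof.
rewrite /Hprod /= big_cons /=; congr (_ * _)%N.
rewrite big_iotaS; apply: eq_big_seq => i; rewrite mem_iota => /andP[i1 _].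
rewrite big_iotaS (_ : part (a :: la) i.+1 = part la i); last by case: i i1.
apply: eq_big_seq => j; rewrite mem_iota => /andP[j1 _].
by rewrite hook_cons //; lia.
Qed.

(** The classical product of all factorials of parts and of [(x + y) / (x - y)] over pairs of parts
    [x > y], arranged by first rows. *)
Fixpoint shifted_hook_formula (la : seq nat) : rat :=
  if la is a :: la' then
    a`!%:R * \prod_(t <- la') ((a%:R + t%:R) / (a%:R - t%:R)) * shifted_hook_formula la'
  else 1.

Lemma Hprod_formula la : sorted gtn la -> (Hprod la)%:R = shifted_hook_formula la.
Proof.
elim: la => [|a la IH] /=; first by rewrite /Hprod big_nil.
move=> pa; rewrite Hprod_cons natrM IH ?(path_sorted pa) //; congr (_ * _).
have /(congr1 (fun n => n%:R : rat)) := first_row_prod _ _ pa.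
have aP : all (gtn a) la by apply: order_path_min pa => x y z /= h1 h2; apply: ltn_trans h2 h1.
rewrite !natrM !natr_prod prodf_div mulrA.
have -> : \prod_(t <- la) (a - t)%:R = \prod_(t <- la) (a%:R - t%:R) :> rat.
  by apply: eq_big_seq => t /(allP aP) /= ta; rewrite natrB // ltnW.
under [in RHS]eq_bigr do rewrite natrD.
move=> <-; rewrite mulfK // prodf_seq_neq0; apply/allP => t /(allP aP) /= ta.
by rewrite subr_eq0 eqr_nat gtn_eqF.
Qed.

(** * Adding a box *)

Lemma is_strictE la : is_strict la = pairwise gtn la && all (fun x => 0 < x)%N la.
Proof. by rewrite /is_strict sorted_pairwise // => x y z /= h1 h2; apply: ltn_trans h2 h1. Qed.

Lemma is_strict_uniq la : is_strict la -> uniq la.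
Proof.
by rewrite is_strictE => /andP[h _]; apply: pairwise_uniq h => x; rewrite /= ltnn.
Qed.

Lemma is_strict_0 la : is_strict la -> 0%N \notin la.
Proof. by case/andP=> _ /allP h; apply/negP => /h. Qed.

(** The only obstruction to growing [s] is a part equal to [s.+1]. Positivity is asked of the other
    parts alone, so that [s = 0] covers a new row. *)
Lemma is_strict_incr l1 s l2 : pairwise gtn (l1 ++ s :: l2) ->
  all (fun x => 0 < x)%N (l1 ++ l2) -> s.+1 \notin l1 ->
  is_strict (l1 ++ s.+1 :: l2).
Proof.
rewrite is_strictE !pairwise_cat !allrel_consr /= !all_cat /=.
move=> /and3P[/andP[h1 h2] h3 /andP[h4 h5]] /andP[h6 h7] sN.
rewrite h2 h3 h5 h6 h7 !andbT; apply/andP; split.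
  apply/allP => x x1; have /= := allP h1 _ x1.
  by rewrite leq_eqVlt => /orP[/eqP e|//]; rewrite e x1 in sN.
by apply: sub_all h4 => x /=; lia.
Qed.

Lemma is_strict_rcons0 la : is_strict la -> pairwise gtn (la ++ [:: 0%N]).
Proof.
by rewrite is_strictE pairwise_cat allrel_consr allrel0r /= andbT => /andP[-> ->].
Qed.

Lemma Hprod_neq0 la : (Hprod la)%:R != 0 :> rat.
Proof.
rewrite pnatr_eq0 -lt0n /Hprod; apply: prodn_gt0 => i; apply: prodn_gt0 => j.
by rewrite /hook; lia.
Qed.

(** For each other part [t], the pair factor changes by [(s + t)(s + 1 - t) / ((s - t)(s + t + 1))],
    which [triB_pred] and [triB_succ] identify as a quotient of differences of triangular numbers.
    The factorial contributes [s.+1%:R^-1]. *)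
Lemma hook_formula_incr l1 s l2 :
  pairwise gtn (l1 ++ s :: l2) -> pairwise gtn (l1 ++ s.+1 :: l2) ->
  shifted_hook_formula (l1 ++ s :: l2) = shifted_hook_formula (l1 ++ s.+1 :: l2) *
    (s.+1%:R^-1 * \prod_(t <- l1 ++ l2) ((tri s.+1 - tri t) / (tri s.+1 - tri t.+1))).
Proof.
elim: l1 => [|a l1 IH] /=.
  move=> /andP[/allP h _] _; rewrite factS natrM.
  have -> : \prod_(t <- l2) ((s%:R + t%:R) / (s%:R - t%:R)) =
      \prod_(t <- l2) ((s.+1%:R + t%:R) / (s.+1%:R - t%:R)) *
      \prod_(t <- l2) ((tri s.+1 - tri t) / (tri s.+1 - tri t.+1)) :> rat.
    rewrite -big_split /=; apply: eq_big_seq => t /h /= ts.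
    have h1 : s%:R - t%:R != 0 :> rat by rewrite subr_eq0 eqr_nat gtn_eqF.
    have h2 : s.+1%:R - t%:R != 0 :> rat by rewrite subr_eq0 eqr_nat gtn_eqF // ltnW.
    have h3 : (s + t).+1%:R != 0 :> rat by rewrite pnatr_eq0.
    rewrite triB_pred triB_succ; move: h2 h3; rewrite -!natr1 natrD => h2 h3.
    by field; rewrite h1 h2 h3.
  by field; rewrite addrC natr1 pnatr_eq0.
move=> /andP[/allP h p1] /andP[/allP h' p2]; rewrite IH // big_cons.
have as1 : (s.+1 < a)%N by apply: h'; rewrite mem_cat inE eqxx orbT.
rewrite !big_cat !big_cons /= triB_pred triB_succ.
set A := \prod_(t <- l1) _; set B := \prod_(t <- l2) _.
have h1 : a%:R - s%:R != 0 :> rat by rewrite subr_eq0 eqr_nat gtn_eqF // ltnW.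
have h2 : a%:R - s.+1%:R != 0 :> rat by rewrite subr_eq0 eqr_nat gtn_eqF.
have h3 : (s + a).+1%:R != 0 :> rat by rewrite pnatr_eq0.
have h4 : s.+1%:R != 0 :> rat by rewrite pnatr_eq0.
have h5 : s%:R - a%:R != 0 :> rat by rewrite -opprB oppr_eq0.
set C := \prod_(t <- l1) _; set D := \prod_(t <- l2) _.
move: h2 h3 h4; rewrite -!natr1 natrD => h2 h3 h4.
by field; rewrite h1 h2 h4 h5 h3.
Qed.

Lemma res_split l1 s l2 : uniq (l1 ++ s :: l2) ->
  res (l1 ++ s :: l2) s = wt s * (s.+1%:R^-1 *
    \prod_(t <- l1 ++ l2) ((tri s.+1 - tri t) / (tri s.+1 - tri t.+1))).
Proof.
rewrite uniq_catC /= mem_cat negb_or => /andP[/andP[s2 s1] _].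
rewrite /res big_cat big_cons eqxx /= -mulrA; congr (_ * (_ * _)).
rewrite [RHS]big_cat; congr (_ * _); rewrite big_seq_cond [RHS]big_seq; apply: eq_bigl => t.
  by case: (boolP (t \in l1)) => //= tl; apply: contraNneq s1 => <-.
by case: (boolP (t \in l2)) => //= tl; apply: contraNneq s2 => <-.
Qed.

(** The numerator at [t = s.+1] vanishes. Hence sums over addable boxes may run over all parts. *)
Lemma res_eq0 la s : s.+1 \in la -> res la s = 0.
Proof.
move=> sl; rewrite /res; apply/eqP; rewrite mulf_eq0; apply/orP; right.
rewrite prodf_seq_eq0; apply/hasP; exists s.+1 => //=.
by rewrite subrr mul0r eqxx andbT; lia.
Qed.

Lemma res_rcons0 la : res (la ++ [:: 0%N]) 0 = res la 0.
Proof. by rewrite /res big_cat /= [X in _ * (_ * X)]big_cons big_nil /= mulr1. Qed.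

Lemma hook_formula_rcons0 la : is_strict la ->
  shifted_hook_formula (la ++ [:: 0%N]) = shifted_hook_formula la.
Proof.
move/is_strict_0; elim: la => [_|a la IH]; first by rewrite /= big_nil !mulr1.
rewrite inE negb_or eq_sym => /andP[a0 laN] /=.
rewrite IH // big_cat big_seq1 mulr0n addr0 divff ?pnatr_eq0 //=.
by rewrite mulr1.
Qed.

(* The second alternative is a new row, viewed as a part s = 0 growing to 1. *)
Lemma box_weight l1 s l2 la (f : seq nat -> rat) (c : rat) :
  is_strict la -> l1 ++ s :: l2 = la \/ [/\ s = 0%N, l2 = [::] & l1 = la] ->
  (is_strict (l1 ++ s.+1 :: l2) -> f (l1 ++ s.+1 :: l2) = c) ->
  wt s * (if is_strict (l1 ++ s.+1 :: l2)
          then f (l1 ++ s.+1 :: l2) / (Hprod (l1 ++ s.+1 :: l2))%:R else 0) =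
  res la s * c / (Hprod la)%:R.
Proof.
move=> sla laE fc.
have [pw po rE sN HE] : [/\ pairwise gtn (l1 ++ s :: l2),
   all (fun x => 0 < x)%N (l1 ++ l2), res la s = res (l1 ++ s :: l2) s,
   s.+1 \in l1 -> s.+1 \in la &
   shifted_hook_formula la = shifted_hook_formula (l1 ++ s :: l2)].
  case: laE => [laE|[s0 l20 l1E]].
    move: sla; rewrite laE is_strictE => /andP[-> h]; split=> //.
      by move: h; rewrite -laE !all_cat /= => /and3P[-> _ ->].
    by rewrite -laE mem_cat => ->.
  rewrite s0 l20 l1E cats0 res_rcons0 hook_formula_rcons0 // is_strict_rcons0 //.
  by split=> //; case/andP: sla.
(* If the box cannot be added, then [s.+1] is already a part and the residue is 0. *)
case: ifP => [st|nst]; last first.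
  rewrite mulr0 res_eq0 ?mul0r // sN //.
  by apply: contraFT nst => sl; apply: is_strict_incr.
have [st' _] := andP st.
have so : sorted gtn la by case/andP: sla.
have E := hook_formula_incr _ _ _ pw.
have pw' : pairwise gtn (l1 ++ s.+1 :: l2) by move: st; rewrite is_strictE => /andP[].
have := Hprod_neq0 la; rewrite (Hprod_formula _ so) HE (E pw') -Hprod_formula // mulf_eq0 negb_or.
move=> /andP[h1 h2]; rewrite fc // rE res_split; last first.
  by apply: pairwise_uniq pw => x; rewrite /= ltnn.
by move: h2; set X := _^-1 * _ => h2; field; rewrite h1 h2.
Qed.

Lemma incr_nth_cat l1 s l2 : incr_nth (l1 ++ s :: l2) (size l1) = l1 ++ s.+1 :: l2.
Proof. by elim: l1 => //= a l1 ->. Qed.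

Lemma incr_nth_size l : incr_nth l (size l) = l ++ [:: 1%N].
Proof. by elim: l => //= a l ->. Qed.

Lemma Dop_res la (f : seq nat -> rat) (F : nat -> rat) : is_strict la ->
  (forall l1 s l2, l1 ++ s :: l2 = la \/ [/\ s = 0%N, l2 = [::] & l1 = la] ->
     is_strict (l1 ++ s.+1 :: l2) -> f (l1 ++ s.+1 :: l2) = F s) ->
  Dop (fun mu => f mu / (Hprod mu)%:R) la =
  (\sum_(s <- 0%N :: la) res la s * F s - f la) / (Hprod la)%:R.
Proof.
move=> sla fF; rewrite /Dop mulrBl; congr (_ - _).
have -> : iota 1 (size la).+1 = iota 1 (size la) ++ [:: (size la).+1].
  by rewrite -(addn1 (size la)) iotaD add1n addn1.
rewrite big_mkcond [X in _ + _ * X]big_mkcond !big_cat !big_seq1.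
rewrite /add_box /= incr_nth_size size_cat addn1 ltnSn (gtn_eqF (ltnSn _)) andbT andbF addr0.
(* Growing an existing row keeps the length, so only the new row survives in the first sum. *)
rewrite big_seq big1 ?add0r; last first.
  move=> i; rewrite mem_iota size_incr_nth => /andP[i1 i2].
  by rewrite (_ : (i.-1 < size la)%N) ?ltnn ?andbF //; lia.
rewrite big_cons [RHS]mulrDl; congr (_ + _).
  rewrite -(box_weight la 0 [::] la f) //; [|by right|by move=> st; apply: fF => //; right].
  by rewrite /wt eqxx mul1r.
rewrite [in RHS](big_nth 0%N) /index_iota subn0 mulr_suml mulr_sumr big_iotaS.
apply: eq_big_seq => i; rewrite mem_iota add0n => /andP[_ il].
have laE : take i la ++ nth 0%N la i :: drop i.+1 la = la.
  by rewrite -drop_nth // cat_take_drop.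
rewrite -(box_weight _ _ _ la f _ sla (or_introl laE)) //; last first.
  by move=> st; apply: fF => //; left.
have -> : incr_nth la i.+1.-1 = take i la ++ (nth 0%N la i).+1 :: drop i.+1 la.
  by rewrite -{1}laE -[X in incr_nth _ X](_ : size (take i la) = i) ?incr_nth_cat // size_takel // ltnW.
rewrite (_ : size _ == size la) ?andbT; last by rewrite -[in X in _ == X]laE !size_cat.
by rewrite /wt (negPf (memPn (is_strict_0 _ sla) _ (mem_nth 0%N il))).
Qed.

(** * The q_k as differences of power sums *)

(** Induction on the number [n] of top rows, with [n.+1 + part la n.+1] in the role of beta_0, which
    it equals at [n = size la]. When the added row is not selected by [P], it ends in the same
    column as the next one: the left side is unchanged and the right side telescopes. A selected row
    adds one pair and one subtracted term. *)
Lemma corner_telescope (la : seq nat) (P : pred nat) (g : nat -> rat) n :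
  (forall i, (0 < i <= n)%N -> ~~ P i -> part la i = (part la i.+1).+1) ->
  let c := [seq i <- rev (iota 1 n) | P i] in
  \sum_(p <- zip ((n.+1 + part la n.+1)%N :: [seq (i + part la i)%N | i <- c]) (c ++ [:: 0%N]))
     g (p.1 - p.2)%N - \sum_(i <- c) g (part la i) =
  \sum_(i <- iota 1 n) (g (part la i).+1 - g (part la i)) + g (part la n.+1).+1.
Proof.
elim: n => [|n IH] Pn.
  by rewrite /= big_seq1 !big_nil subr0 add0r subn0 add1n.
have {}IH := IH (fun i hi => Pn i (introT andP (conj (proj1 (andP hi)) (leqW (proj2 (andP hi)))))).
have iotaE : iota 1 n.+1 = iota 1 n ++ [:: n.+1] by rewrite -(addn1 n) iotaD add1n addn1.
move: IH; cbv zeta => IH; rewrite iotaE rev_cat filter_cat [in RHS]big_cat big_seq1.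
move: IH; set c := [seq i <- rev (iota 1 n) | P i] => IH.
have -> : [seq i <- rev [:: n.+1] | P i] = if P n.+1 then [:: n.+1] else [::] by [].
case: ifP => Pn1; last first.
  rewrite [_ ++ c]/= (_ : (n.+2 + part la n.+2 = n.+1 + part la n.+1)%N); last first.
    by rewrite (Pn n.+1) ?Pn1 ?leqnn // addnS addSn.
  by rewrite IH -(Pn n.+1) ?Pn1 ?leqnn // -addrA subrK.
rewrite [_ ++ c]/= [zip _ _]/= !big_cons [X in g X](_ : _ = (part la n.+2).+1); last first.
  by rewrite /= addSn -addnS addKn.
by rewrite opprD addrACA IH /=; ring.
Qed.

Lemma rem_box_noncorner la i : is_strict la -> (0 < i <= size la)%N ->
  ~~ is_strict (rem_box la i) -> part la i = (part la i.+1).+1.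
Proof.
case: i => // i sla /andP[_ il]; apply: contraNeq => ne.
have laE : take i la ++ nth 0%N la i :: drop i.+1 la = la.
  by rewrite -drop_nth // cat_take_drop.
have st : size (take i la) = i by rewrite size_takel // ltnW.
move: ne; rewrite /rem_box /=; set s := nth 0%N la i => ne.
(* Dropping the last row would mean [s = 1], one more than the default part 0 past the end, which
   [ne] excludes. *)
have -> : ((i.+1 == size la) && (s == 1%N)) = false.
  apply/negP => /andP[/eqP e /eqP s1].
  by move: ne; rewrite s1 nth_default ?eqxx // -e.
have -> : set_nth 0%N la i s.-1 = take i la ++ s.-1 :: drop i.+1 la.
  by rewrite set_nthE il.
move: ne (sla); rewrite -{2}laE -/s !is_strictE !pairwise_cat !allrel_consr !all_cat /=.
move=> ne /andP[/and3P[/andP[h1 h2] h3 /andP[h4 h5]] /and3P[h6 h7 h8]].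
rewrite h2 h3 h5 h6 h8 !andbT.
have yE : nth 0%N la i.+1 = head 0%N (drop i.+1 la) by rewrite -nth0 nth_drop addn0.
have [sd s0] : all (gtn s.-1) (drop i.+1 la) /\ (0 < s.-1)%N.
  move: ne h4 h5; rewrite yE; case: (drop i.+1 la) => [|y d] /= ne.
    by move=> _ _; split=> //; lia.
  move=> /andP[ys _] /andP[yd _]; split; last by lia.
  apply/andP; split; first by lia.
  by apply: sub_all yd => x /=; lia.
rewrite sd s0 !andbT; apply: sub_all h1 => x /=; lia.
Qed.

(** The end term of the telescoping is [tri 1 ^+ k] with [tri 1 = 0], hence the 1 at [k = 0]. *)
Lemma qk_strict k la : is_strict la -> qk k la = (k == 0%N)%:R + qsum k la.
Proof.
move=> sla; rewrite /qk.
have := @corner_telescope la (fun i => is_strict (rem_box la i)) (fun x => tri x ^+ k) (size la).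
move=> /(_ (fun i hi => @rem_box_noncorner la i sla hi)) /=.
have p0 : part la (size la).+1 = 0%N by rewrite /= nth_default.
rewrite -[nth 0 la (size la)]/(part la (size la).+1) p0 addn0.
rewrite [X in X = _ -> _](_ : _ = qk k la); last first.
  rewrite /qk /xs /ys !big_map /corner_rows; congr (_ - _).
  by apply: eq_bigr => i _; rewrite addKn.
rewrite /qk => ->.
by rewrite addrC [tri 1](_ : _ = 0) // expr0n /qsum big_iotaS [in RHS](big_nth 0%N) /index_iota subn0.
Qed.

(** * Weighted degree in the q_k *)

(** The increment of q_k as a polynomial in [z = tri s.+1]. The recurrence is that of the power sums
    of the two neighbours of [z]; the term ['X^k2 *+ 4] corrects for the middle term [- 2 z ^ k]. *)
Fixpoint second_diff (k : nat) : {poly rat} :=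
  match k with
  | 0%N => 0
  | 1%N => 1
  | (k1.+1 as k2).+1 =>
      ('X *+ 2 + 1) * second_diff k2 - ('X ^+ 2 - 'X) * second_diff k1 + 'X^k2 *+ 4
  end.

Lemma second_diffSS k : second_diff k.+2 =
  ('X *+ 2 + 1) * second_diff k.+1 - ('X ^+ 2 - 'X) * second_diff k + 'X^(k.+1) *+ 4.
Proof. by []. Qed.

(** This degree bound is the source of the loss of weight. *)
Lemma size_second_diff k : (size (second_diff k) <= k)%N.
Proof.
suff: (size (second_diff k) <= k)%N /\ (size (second_diff k.+1) <= k.+1)%N by case.
elim: k => [|k [IH0 IH1]]; first by rewrite /= size_poly0 size_poly1.
split=> //; rewrite second_diffSS.
have s2 : (size ('X *+ 2 + 1 : {poly rat})%R <= 2)%N.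
  apply: (leq_trans (size_polyD _ _)); rewrite geq_max size_poly1 andbT.
  by rewrite -scaler_nat (leq_trans (size_scale_leq _ _)) // size_polyX.
have s3 : (size ('X ^+ 2 - 'X : {poly rat})%R <= 3)%N.
  by apply: (leq_trans (size_polyD _ _)); rewrite size_polyN size_polyX size_polyXn.
have s4 : (size ('X^(k.+1) *+ 4 : {poly rat})%R <= k.+2)%N.
  by rewrite -scaler_nat (leq_trans (size_scale_leq _ _)) // size_polyXn.
apply: (leq_trans (size_polyD _ _)); rewrite geq_max s4 andbT.
apply: (leq_trans (size_polyD _ _)); rewrite size_polyN geq_max.
have sM (p q : {poly rat}) a c : (size p <= a.+1)%N -> (size q <= c)%N ->
    (size (p * q)%R <= a + c)%N.
  by move=> pa qc; apply: (leq_trans (size_polyMleq _ _)); move: (size p) (size q) pa qc; lia.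
by rewrite (sM _ _ 1%N k.+1) // (sM _ _ 2%N k).
Qed.

(* With z = tri s.+1, the two neighbours of z are the roots of x^2 - (2 z + 1) x + z^2 - z. *)
Lemma second_diffE k s :
  (second_diff k).[tri s.+1] = tri s.+2 ^+ k - tri s.+1 ^+ k *+ 2 + tri s ^+ k.
Proof.
suff: (second_diff k).[tri s.+1] = tri s.+2 ^+ k - tri s.+1 ^+ k *+ 2 + tri s ^+ k /\
  (second_diff k.+1).[tri s.+1] = tri s.+2 ^+ k.+1 - tri s.+1 ^+ k.+1 *+ 2 + tri s ^+ k.+1 by case.
elim: k => [|k [IH0 IH1]].
  by rewrite /= !hornerE !expr0 !expr1 !triS -natr1; split; ring.
split=> //; rewrite second_diffSS.
rewrite !(hornerE, hornerMn) IH0 IH1.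
have sE : tri s ^+ 2 = tri s *+ 2 * tri s.+1 + tri s - (tri s.+1 ^+ 2 - tri s.+1).
  by rewrite !triE -natr1; field.
have tE : tri s.+2 ^+ 2 = tri s.+2 *+ 2 * tri s.+1 + tri s.+2 - (tri s.+1 ^+ 2 - tri s.+1).
  by rewrite !triE -(natr1 s.+1) -natr1; field.
have sE' : tri s ^+ k.+2 =
   (tri s *+ 2 * tri s.+1 + tri s - (tri s.+1 ^+ 2 - tri s.+1)) * tri s ^+ k.
  by rewrite -sE -exprD.
have tE' : tri s.+2 ^+ k.+2 =
   (tri s.+2 *+ 2 * tri s.+1 + tri s.+2 - (tri s.+1 ^+ 2 - tri s.+1)) * tri s.+2 ^+ k.
  by rewrite -tE -exprD.
rewrite sE' tE' !exprS /=; ring.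
Qed.

(** Only the summand of [s] changes, and its first difference of powers becomes a second difference.
    A part 0 contributes nothing to [qsum], so a new row is no exception. *)
Lemma qk_incr k l1 s l2 la : is_strict la ->
  l1 ++ s :: l2 = la \/ [/\ s = 0%N, l2 = [::] & l1 = la] ->
  is_strict (l1 ++ s.+1 :: l2) ->
  qk k (l1 ++ s.+1 :: l2) = qk k la + (second_diff k).[tri s.+1].
Proof.
move=> sla laE st; rewrite !qk_strict // -addrA; congr (_ + _).
have -> : qsum k la = qsum k (l1 ++ s :: l2).
  case: laE => [-> //|[-> -> ->]].
  by rewrite /qsum big_cat big_seq1 [tri 1](_ : _ = tri 0) // subrr /= addr0.
by rewrite second_diffE /qsum !big_cat !big_cons /=; ring.
Qed.

(* Weighted degree less than n as a polynomial in q_1, q_2, ..., on strict partitions. *)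
Definition qdeg_lt (n : nat) (f : seq nat -> rat) : Prop :=
  exists l : seq (rat * seq nat),
    all (fun p => sumn p.2 < n)%N l /\
    forall la, is_strict la -> f la = \sum_(p <- l) p.1 * qnu p.2 la.

Lemma qdeg_lt_ext n f g :
  (forall la, is_strict la -> f la = g la) -> qdeg_lt n g -> qdeg_lt n f.
Proof. by move=> fg [l [ln gE]]; exists l; split=> // la sla; rewrite fg // gE. Qed.

Lemma qdeg_lt_leq m n f : (m <= n)%N -> qdeg_lt m f -> qdeg_lt n f.
Proof.
move=> mn [l [lm fE]]; exists l; split=> //.
by apply: sub_all lm => p /leq_trans; apply.
Qed.

Lemma qdeg_lt_sum n (I : eqType) (r : seq I) (F : I -> seq nat -> rat) :
  (forall i, i \in r -> qdeg_lt n (F i)) -> qdeg_lt n (fun la => \sum_(i <- r) F i la).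
Proof.
elim: r => [|i r IH] Fn; first by exists [::]; split=> // la _; rewrite !big_nil.
have [l [ln lE]] := Fn i (mem_head _ _).
have [|l' [ln' lE']] := IH; first by move=> j jr; apply: Fn; rewrite inE jr orbT.
exists (l ++ l'); split; first by rewrite all_cat ln.
by move=> la sla; rewrite big_cons big_cat lE // lE'.
Qed.

Lemma qdeg_lt_mul n (c : rat) d f : qdeg_lt n f ->
  qdeg_lt (sumn d + n) (fun la => c * qnu d la * f la).
Proof.
move=> [l [ln fE]]; exists [seq (c * p.1, d ++ p.2) | p <- l]; split.
  by rewrite all_map; apply: sub_all ln => p /=; rewrite sumn_cat ltn_add2l.
move=> la sla; rewrite fE // big_map mulr_sumr; apply: eq_bigr => p _ /=.
by rewrite [qnu (_ ++ _) _]/qnu big_cat /= -!/(qnu _ _); ring.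
Qed.

Lemma qdeg_lt_scale n (c : rat) f : qdeg_lt n f -> qdeg_lt n (fun la => c * f la).
Proof.
move/(qdeg_lt_mul _ c [::]); apply: qdeg_lt_ext => la _.
by rewrite /qnu big_nil mulr1.
Qed.

(** Newton's identity, divided by [k.+1], expresses a moment through earlier moments times single
    q_i, with total weight preserved. *)
Lemma qdeg_lt_moment k : qdeg_lt k.+1 (moment^~ k).
Proof.
elim/ltn_ind: k => -[_|k IH].
  exists [:: (1, [::])]; split=> // la sla.
  by rewrite big_seq1 /qnu big_nil mulr1 moment0 ?is_strict_uniq ?is_strict_0.
apply: (@qdeg_lt_ext _ _ (fun la => \sum_(i <- index_enum 'I_k.+1)
     k.+1%:R^-1 * qnu [:: i.+1] la * moment la (k - i))).
  move=> la sla; have := moment_newton _ (is_strict_uniq _ sla) (is_strict_0 _ sla) k.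
  move=> /(canRL (mulKf _)) ->; last by rewrite pnatr_eq0.
  rewrite mulr_sumr; apply: eq_bigr => i _.
  by rewrite /qnu big_seq1 qk_strict // add0r mulrA.
apply: qdeg_lt_sum => i _; have ik := ltn_ord i.
apply: (@qdeg_lt_leq (sumn [:: i.+1] + (k - i).+1)); first by rewrite /=; lia.
by apply: qdeg_lt_mul; apply: IH; lia.
Qed.

Lemma qdeg_lt_res (p : {poly rat}) :
  qdeg_lt (size p) (fun la => \sum_(s <- 0%N :: la) res la s * p.[tri s.+1]).
Proof.
apply: (@qdeg_lt_ext _ _ (fun la => \sum_(i <- index_enum 'I_(size p)) p`_i * moment la i)).
  move=> la _; under eq_bigr do rewrite horner_coef mulr_sumr.
  rewrite exchange_big; apply: eq_bigr => i _.
  by rewrite /moment mulr_sumr; apply: eq_bigr => s _; rewrite mulrCA.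
apply: qdeg_lt_sum => i _; apply: qdeg_lt_scale.
by apply: qdeg_lt_leq (qdeg_lt_moment i); apply: ltn_ord.
Qed.

(** Every term except [qnu nu la] uses some [r k], which trades weight [k] for degree at most
    [k - 1]. Since [size] exceeds the degree by one, the bound with [<=] records a strict loss. *)
Lemma qnu_shift_expansion (r : nat -> {poly rat}) (nu : seq nat) :
  (forall k, size (r k) <= k)%N ->
  exists L : seq (seq nat * {poly rat}),
    (forall t, t \in L -> sumn t.1 + size t.2 <= sumn nu)%N /\
    forall la z, \prod_(k <- nu) (qk k la + (r k).[z]) =
      qnu nu la + \sum_(t <- L) qnu t.1 la * t.2.[z].
Proof.
move=> rk; elim: nu => [|k nu [L [LP LE]]].
  by exists [::]; split=> // la z; rewrite /qnu !big_nil addr0.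
(* The new factor gives [r k] times the main term, [qk k] times the remainder, and [r k] times the
   remainder. *)
exists ((nu, r k) :: [seq (k :: t.1, t.2) | t <- L] ++ [seq (t.1, r k * t.2) | t <- L]); split.
  move=> t; rewrite inE mem_cat => /or3P[/eqP->|/mapP[t' /LP h ->]|/mapP[t' /LP h ->]] /=.
  - by rewrite addnC leq_add2r rk.
  - by rewrite -addnA leq_add2l.
  - rewrite (leq_trans _ (leq_add (rk k) h)) // addnCA leq_add2l.
    exact: leq_trans (size_polyMleq _ _) (leq_pred _).
move=> la z; rewrite !big_cons LE [qnu (k :: nu) la]/qnu big_cons -/(qnu nu la).
rewrite big_cat !big_map /= mulrDl !mulrDr -!addrA; congr (_ + _).
rewrite addrCA [(r k).[z] * _]mulrC; congr (_ + _); rewrite !mulr_sumr; congr (_ + _).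
  by apply: eq_bigr => t _; rewrite [qnu (k :: _) _]/qnu big_cons mulrA.
by apply: eq_bigr => t _; rewrite hornerM mulrCA.
Qed.

Lemma Dop_qnu_qdeg nu : exists2 f, qdeg_lt (sumn nu) f &
  forall la, is_strict la ->
    Dop (fun mu => qnu nu mu / (Hprod mu)%:R) la = f la / (Hprod la)%:R.
Proof.
have [L [LP LE]] := qnu_shift_expansion second_diff nu size_second_diff.
exists (fun la => \sum_(t <- L) 1 * qnu t.1 la *
    \sum_(s <- 0%N :: la) res la s * t.2.[tri s.+1]).
  apply: qdeg_lt_sum => t tL; apply: qdeg_lt_leq (LP t tL) _.
  by apply: qdeg_lt_mul; apply: qdeg_lt_res.
move=> la sla.
rewrite (@Dop_res la (qnu nu) (fun s => \prod_(k <- nu) (qk k la + (second_diff k).[tri s.+1]))) //.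
  congr (_ / _); under eq_bigr do rewrite LE mulrDr.
  rewrite big_split /= -mulr_suml.
  (* As the residues sum to 1, the main term is exactly [qnu nu la] and cancels against the
     subtracted term of the operator. *)
  have -> : \sum_(s <- 0%N :: la) res la s = 1.
    rewrite -(moment0 _ (is_strict_uniq _ sla) (is_strict_0 _ sla)).
    by apply: eq_bigr => s _; rewrite expr0 mulr1.
  rewrite mul1r addrAC subrr add0r.
  under eq_bigr do rewrite mulr_sumr.
  rewrite exchange_big; apply: eq_bigr => t _; rewrite mul1r mulr_sumr.
  by apply: eq_bigr => s _; rewrite mulrCA.
move=> l1 s l2 laE st; rewrite /qnu; apply: eq_bigr => k _.
exact: qk_incr.
Qed.

(** * From index sequences to partitions *)

Definition to_partition (d : seq nat) : seq nat := sort geq [seq x <- d | (0 < x)%N].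

Lemma to_partitionP d : is_partition (to_partition d).
Proof.
apply/andP; split; first by apply: sort_sorted => x y; rewrite orbC leq_total.
by rewrite all_sort filter_all.
Qed.

Lemma sumn_to_partition d : sumn (to_partition d) = sumn d.
Proof.
rewrite /to_partition (perm_sumn (permEl (perm_sort _ _))).
by elim: d => //= x d <-; case: x.
Qed.

Lemma qnu_to_partition d la : is_strict la -> qnu (to_partition d) la = qnu d la.
Proof.
move=> sla; rewrite /qnu (perm_big _ (permEl (perm_sort _ _))) big_filter big_mkcond /=.
apply: eq_bigr => -[|k] _ //=; rewrite qk_strict // /qsum big1 ?addr0 // => t _.
Qed.

Lemma to_partition_id d m : is_partition d -> to_partition (d ++ nseq m 0%N) = d.
Proof.
move=> /andP[sd pd]; rewrite /to_partition filter_cat (all_filterP pd).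
rewrite (_ : [seq x <- nseq m 0%N | (0 < x)%N] = [::]); last by elim: m.
by rewrite cats0 sorted_sort // => x y z /= h1 h2; apply: leq_trans h2 h1.
Qed.

Lemma finitely_many_partitions n : exists deltas : seq (seq nat), uniq deltas /\
  forall d, (d \in deltas) = is_partition d && (sumn d < n)%N.
Proof.
(* A partition of sum below [n] has at most [n] parts, all below [n]; padded with zeros it is an
   [n]-tuple over ['I_n], from which [to_partition] recovers it. *)
pose s := [seq to_partition [seq val i | i <- tval t] | t <- enum {: n.-tuple 'I_n}].
exists [seq d <- undup s | (sumn d < n)%N]; split; first by rewrite filter_uniq ?undup_uniq.
move=> d; rewrite mem_filter mem_undup andbC; apply/andP/andP=> [] [h1 h2]; split=> //.
  by case/mapP: h1 => t _ ->; apply: to_partitionP.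
have dn x : x \in d -> (x < n)%N.
  by move=> xd; apply: leq_ltn_trans h2; rewrite (perm_sumn (perm_to_rem xd)) /= leq_addr.
have szd : (size d <= n)%N.
  have /andP[_ pd] := h1; apply: leq_trans (ltnW h2).
  by elim: (d) pd => //= x l IH /andP[x0 /IH]; lia.
have n0 : (0 < n)%N by case: (n) h2.
pose t := [tuple Ordinal (ltn_pmod (nth 0%N d i) n0) | i < n].
apply/mapP; exists t; first by rewrite mem_enum.
rewrite -[LHS](to_partition_id d (n - size d)%N) //; congr to_partition.
apply: (@eq_from_nth _ 0%N); first by rewrite size_cat size_nseq size_map size_tuple subnKC.
move=> i; rewrite size_cat size_nseq subnKC // => iN.
have -> : nth 0%N [seq val j | j <- tval t] i = (nth 0%N d i %% n)%N.
  rewrite (nth_map (Ordinal iN)) ?size_tuple // -[i]/(val (Ordinal iN)) -tnth_nth.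
  by rewrite tnth_mktuple.
rewrite nth_cat nth_nseq; case: ltnP => id.
  by rewrite modn_small // dn // mem_nth.
by rewrite nth_default // mod0n; case: ifP.
Qed.

Theorem theorem3p6 (nu : seq nat) :
  is_partition nu ->
  exists (deltas : seq (seq nat)) (xi : seq nat -> rat),
    uniq deltas /\
    (forall d, d \in deltas -> is_partition d /\ (sumn d < sumn nu)%N) /\
    (forall d, is_partition d -> (sumn d < sumn nu)%N -> d \in deltas) /\
    forall la : seq nat, is_strict la ->
      Dop (fun mu => qnu nu mu / (Hprod mu)%:R) la =
      \sum_(d <- deltas) xi d * (qnu d la / (Hprod la)%:R).
Proof.
move=> _; have [f [l [ln fE]] DE] := Dop_qnu_qdeg nu.
have [deltas [du dP]] := finitely_many_partitions (sumn nu).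
(* Several monomials may normalise to the same partition, so their coefficients are added up. *)
exists deltas, (fun d => \sum_(p <- l | to_partition p.2 == d) p.1); split=> //.
split; first by move=> d; rewrite dP => /andP.
split; first by move=> d pd sd; rewrite dP pd.
move=> la sla; rewrite DE // fE // mulr_suml.
under [RHS]eq_bigr do rewrite mulr_suml big_mkcond.
rewrite exchange_big; apply: eq_big_seq => p pl /=.
rewrite (bigD1_seq (to_partition p.2)) //=; last first.
  by rewrite dP to_partitionP sumn_to_partition; apply: (allP ln).
rewrite eqxx qnu_to_partition // big1 ?addr0 ?mulrA // => d /negPf.
by rewrite eq_sym => ->.
Qed.
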